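(* Let $k\geq 3$ be an integer. For a complete bipartite graph $K_{s,t}$ with integers $t\geq s\geq 2(k-1)$, we have $px_k(K_{s,t})=2$.
   Context: All graphs are simple, finite, undirected and connected. $K_{s,t}$ denotes the complete bipartite graph with partite sets of sizes $s$ and $t$. An edge-coloring of a graph $G$ is any map $c:E(G)\to\{1,\dots,m\}$, $m\in\mathbb{N}$ (adjacent edges may receive the same color). A tree $T$ that is a subgraph of an edge-colored graph $G$ is a proper tree if no two adjacent edges of $T$ are assigned the same color. For $S\subseteq V(G)$, an $S$-tree is a tree that is a subgraph of $G$ and contains all vertices of $S$. For a connected graph $G$ of order $n$ and an integer $k$ with $2\le k\le n$, a $k$-proper coloring of $G$ is an edge-coloring such that for every set $S$ of $k$ vertices of $G$ there exists a proper $S$-tree in $G$. The $k$-proper index $px_k(G)$ is the minimum number of colors required in a $k$-proper coloring of $G$. *)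

(* Defs.v *)
From mathcomp Require Import all_boot.
From mathcomp Require classical_sets.

Set Implicit Arguments.
Unset Strict Implicit.
Unset Printing Implicit Defensive.

Record sgraph := SGraph {
  vertex :> finType;
  adj : rel vertex;
  adj_sym : symmetric adj;
  adj_irrefl : irreflexive adj }.

Definition edges (G : sgraph) : {set {set G}} :=
  [set [set p.1; p.2] | p in [pred p : G * G | adj p.1 p.2]].

Definition biclique_adj (s t : nat) : rel ('I_s + 'I_t)%type :=
  fun x y => match x, y with
             | inl _, inr _ | inr _, inl _ => true
             | _, _ => false
             end.

Lemma biclique_sym s t : symmetric (@biclique_adj s t).
Proof. by case=> x [y|y]. Qed.

Lemma biclique_irrefl s t : irreflexive (@biclique_adj s t).
Proof. by case. Qed.

Definition biclique (s t : nat) : sgraph :=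
  SGraph (@biclique_sym s t) (@biclique_irrefl s t).

Section Trees.
Variable G : sgraph.
Implicit Types (W S : {set G}) (F : {set {set G}}).

(* The pair (W, F), of a vertex set and an edge set, is a subgraph of G. *)
Definition subgraph W F : Prop :=
  F \subset edges G /\ (forall e, e \in F -> e \subset W).

Definition edge_rel F : rel G := fun x y => [set x; y] \in F.

Definition connected_in W F : Prop :=
  forall x y, x \in W -> y \in W -> connect (edge_rel F) x y.

(* [ucycle] also accepts the degenerate cycles x - y - x of length 2. *)
Definition acyclic F : Prop :=
  forall p : seq G, 2 < size p -> ~ ucycle (edge_rel F) p.

Definition tree W F : Prop :=
  [/\ subgraph W F, 0 < #|W|, connected_in W F & acyclic F].

(* A coloring is a function on all vertex sets; only its values on the edges
   of G are constrained, and only those are ever used. *)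
Definition edge_coloring (m : nat) (c : {set G} -> nat) : Prop :=
  forall e, e \in edges G -> 1 <= c e <= m.

Definition properly_colored (c : {set G} -> nat) F : Prop :=
  forall e f, e \in F -> f \in F -> e != f -> ~~ [disjoint e & f] ->
  c e != c f.

Definition proper_Stree (c : {set G} -> nat) S W F : Prop :=
  [/\ tree W F, S \subset W & properly_colored c F].

Definition k_proper_coloring (k m : nat) (c : {set G} -> nat) : Prop :=
  edge_coloring m c /\
  (forall S, #|S| = k -> exists W F, proper_Stree c S W F).

Definition k_proper_colorable (k m : nat) : Prop :=
  exists c, k_proper_coloring k m c.

(* The least m for which G has a k-proper coloring with colors 1, ..., m. The
   default value 0 is returned when there is none, which does not happen for
   a connected graph of order n and 2 <= k <= n. *)
Definition px (k : nat) : nat :=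
  classical_sets.xget 0 (fun m => k_proper_colorable k m /\
                           forall n, k_proper_colorable k n -> m <= n).

End Trees.

(* Main.v *)
(* Reading color 1 as "from U to W" and color 2 as "from W to U", a 2-coloring
   of K_{s,t} is an orientation and an alternating path is a directed path.
   Split U and W into halves with at least k - 1 vertices each and orient the
   graph as a blow-up of the directed 4-cycle U1 -> W1 -> U2 -> W2 -> U1.  If
   no part contains all of S, going k - 1 times around the cycle through k - 1
   vertices of each part can be made to cover S; if S lies in one part, start
   in it and end with one more vertex of it.  With a single color, a proper
   tree has at most one edge, so it cannot contain three vertices. *)
Require Import Defs.
From mathcomp Require Import all_boot zify.
From mathcomp Require classical_sets.

Set Implicit Arguments.
Unset Strict Implicit.
Unset Printing Implicit Defensive.

(** * Paths as trees *)

Section PathTree.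
Variables (G : sgraph) (n : nat) (v : nat -> G).
Hypothesis n_gt0 : 0 < n.
Hypothesis v_inj : {in [pred i | i < n] &, injective v}.
Hypothesis v_adj : forall i, i.+1 < n -> adj (v i) (v i.+1).

Definition path_vertices : {set G} := [set v i | i : 'I_n].
Definition path_edges : {set {set G}} :=
  [set [set v i; v i.+1] | i : 'I_n.-1].

Lemma path_edgesP e :
  reflect (exists2 i, i.+1 < n & e = [set v i; v i.+1]) (e \in path_edges).
Proof.
apply: (iffP imsetP) => [[i _ ->]|[i hi ->]].
  by exists i => //; move: (ltn_ord i); lia.
have hi' : i < n.-1 by lia.
by exists (Ordinal hi').
Qed.

Lemma path_verticesP x :
  reflect (exists2 i, i < n & x = v i) (x \in path_vertices).
Proof.
apply: (iffP imsetP) => [[i _ ->]|[i hi ->]]; first by exists i.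
by exists (Ordinal hi).
Qed.

Lemma path_edge_relP x y : edge_rel path_edges x y ->
  exists2 i, i.+1 < n & (x = v i /\ y = v i.+1) \/ (x = v i.+1 /\ y = v i).
Proof.
move=> /path_edgesP[i hi E]; exists i => //.
have vN : v i != v i.+1 by apply/eqP => /v_inj; rewrite !inE; lia.
have /set2P hx : x \in [set v i; v i.+1] by rewrite -E set21.
have /set2P hy : y \in [set v i; v i.+1] by rewrite -E set22.
case: hx hy E => -> [] -> E; [|by left|by right|].
  by move: (set22 (v i) (v i.+1)); rewrite -E !inE orbb eq_sym (negPf vN).
by move: (set21 (v i) (v i.+1)); rewrite -E !inE orbb (negPf vN).
Qed.

(* The vertex of largest index on a cycle would have its two distinct
   neighbours at the same index. *)
Lemma path_acyclic : acyclic path_edges.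
Proof.
move=> p p_gt2 /andP[p_cyc p_uniq].
have [x0 x0p] : exists x, x \in p.
  by case: p p_gt2 {p_cyc p_uniq} => // a p _; exists a; rewrite mem_head.
pose idx x := find (fun i => v i == x) (iota 0 n).
have idxE i : i < n -> idx (v i) = i.
  move=> hi; rewrite /idx.
  have has_i : has (fun j => v j == v i) (iota 0 n).
    by apply/hasP; exists i; rewrite ?mem_iota.
  have := nth_find 0 has_i.
  move: has_i; rewrite has_find size_iota => lt_n.
  by rewrite nth_iota // add0n => /eqP /v_inj -> //.
have [m mp m_max] : exists2 m, m \in p & forall x, x \in p -> idx x <= idx m.
  by case: (@arg_maxnP _ x0 (mem p) idx x0p) => m mp m_max; exists m.
have step x : x \in p -> edge_rel path_edges m x -> idx m > 0 /\ x = v (idx m).-1.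
  move=> xp /path_edge_relP[i hi []] [E1 E2].
    by move: (m_max x xp); rewrite E1 E2 !idxE; lia.
  by rewrite E1 idxE //= E2.
(* With [m] rotated to the front, its neighbours on the cycle are the first and last entries of the
   rest; length above 2 makes these separate entries. *)
case/rot_to: (mp) => i q rotE.
have q_mem x : x \in q -> x \in p.
  by move=> xq; rewrite -(mem_rot i) rotE inE xq orbT.
move: p_cyc p_uniq p_gt2; rewrite -(rot_cycle i) -(rot_uniq i) -(size_rot i) rotE.
case: q rotE q_mem => [|a q] // rotE q_mem.
case/lastP: q rotE q_mem => [|q b] // rotE q_mem /=.
rewrite rcons_path last_rcons => /and3P[ma _ bm] /and3P[_ + _] _.
have mb : edge_rel path_edges m b by rewrite /edge_rel setUC.
have [_ ->] := step a (q_mem _ (mem_head _ _)) ma.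
have [|_ ->] := step b (q_mem _ _) mb; first by rewrite inE mem_rcons mem_head orbT.
by rewrite mem_rcons mem_head.
Qed.

Lemma path_connected : connected_in path_vertices path_edges.
Proof.
have sym : connect_sym (edge_rel path_edges).
  by apply: sym_connect_sym => x y; rewrite /edge_rel setUC.
have from0 i : i < n -> connect (edge_rel path_edges) (v 0) (v i).
  elim: i => [|i IH] hi; first exact: connect0.
  apply: connect_trans (IH (ltnW hi)) (connect1 _).
  by apply/path_edgesP; exists i.
move=> x y /path_verticesP[i hi ->] /path_verticesP[j hj ->].
by apply: connect_trans (from0 _ hj); rewrite sym from0.
Qed.

Lemma path_tree : tree path_vertices path_edges.
Proof.
split; [split| |exact: path_connected|exact: path_acyclic].
- apply/subsetP => e /path_edgesP[i hi ->].
  by apply/imsetP; exists (v i, v i.+1); rewrite ?inE ?v_adj.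
- move=> e /path_edgesP[i hi ->]; apply/subsetP => x /set2P[]->; apply/path_verticesP.
    by exists i; first lia.
  by exists i.+1.
- by apply/card_gt0P; exists (v 0); apply/path_verticesP; exists 0.
Qed.

(** Distinct edges of the path meet only when their indices are consecutive. *)
Lemma path_properly_colored (c : {set G} -> nat) :
  (forall i, i.+2 < n -> c [set v i; v i.+1] != c [set v i.+1; v i.+2]) ->
  properly_colored c path_edges.
Proof.
move=> c_alt e f /path_edgesP[i hi ->] /path_edgesP[j hj ->] ne.
rewrite disjoints_subset => /subsetPn[x xi]; rewrite inE negbK => xj.
have ij : i <> j by move=> E; rewrite E eqxx in ne.
have [E|E] : j = i.+1 \/ i = j.+1.
  by case/set2P: xi => ->{x} in xj *; case/set2P: xj => /v_inj; rewrite !inE; lia.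
- by rewrite E c_alt // -E.
- by rewrite E eq_sym c_alt // -E.
Qed.

End PathTree.

(** Two edges of [F] at one vertex would both have color 1, so [F] is a matching. Connectedness then
    joins any two vertices of [S] by an edge, and three of them would give a vertex two
    neighbours. *)
Lemma monochromatic_tree_small (G : sgraph) (c : {set G} -> nat) m S W F :
  edge_coloring m c -> m <= 1 -> proper_Stree c S W F -> #|S| <= 2.
Proof.
move=> c_col m_le1 [[[FE _] _ F_con _] SW c_prop].
have F_adj x y z : edge_rel F x y -> edge_rel F x z -> y = z.
  move=> xy xz; apply/eqP/negPn/negP => yz.
  have := c_prop _ _ xy xz.
  have /c_col c1 := subsetP FE _ xy; have /c_col c2 := subsetP FE _ xz.
  have -> : c [set x; y] = c [set x; z] by lia.
  rewrite eqxx => H; suff: false by []; apply: H.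
    apply: contra yz => /eqP E.
    have /set2P[yx|->//] : y \in [set x; z] by rewrite -E set22.
    have : z \in [set x; y] by rewrite E set22.
    by rewrite yx !inE orbb eq_sym.
  by apply/pred0Pn; exists x; rewrite /= !set21.
have F_full x y : x \in S -> y \in S -> x != y -> edge_rel F x y.
  move=> /(subsetP SW) xW /(subsetP SW) yW.
  case/connectP: (F_con _ _ xW yW) => p /shortenP[q q_path q_uniq _] -> {p}.
  case: q q_path q_uniq => [|a [|b q]] /=; rewrite ?eqxx ?andbT //.
  move=> /and3P[xa ab _] + _.
  (* Both [x] and [b] are neighbours of [a], yet the path has no repetition. *)
  have -> : x = b by apply: F_adj ab; rewrite /edge_rel setUC.
  by rewrite !inE eqxx orbT.
rewrite leqNgt; apply/negP => /card_gt2P[x [y [z [[xS yS zS] [xy yz zx]]]]].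
have E : y = z by apply: (@F_adj x); apply: F_full => //; rewrite eq_sym.
by rewrite E eqxx in yz.
Qed.

(** * The cyclic 2-coloring *)

Section Coloring.
Variables (k s t : nat).
Hypotheses (hk : 3 <= k) (hs : 2 * (k - 1) <= s) (hst : s <= t).
Let G := biclique s t.

(* The parts U1, W1, U2, W2 are numbered 0, 1, 2, 3 in cyclic order. *)
Definition part (x : G) : nat :=
  match x with
  | inl u => if u < k - 1 then 0 else 2
  | inr w => if w < k - 1 then 1 else 3
  end.

(** On edges, color 1 is U1-W1 and U2-W2, color 2 is W1-U2 and W2-U1. Quantifying over [e] avoids
    ordering its endpoints. *)
Definition cyclic_coloring (e : {set G}) : nat :=
  if [forall x in e, forall y in e, (part x)./2 == (part y)./2] then 1 else 2.

Lemma part_adj x y : adj x y = odd (part x + part y).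
Proof. by case: x y => [u|w] [u'|w'] /=; do 2 case: ifP. Qed.

Lemma part_lt4 x : part x < 4.
Proof. by case: x => [u|w] /=; case: ifP. Qed.

Lemma card_part j : j < 4 -> k - 1 <= #|[set x : G | part x == j]|.
Proof.
move=> j4.
have ls i : i < k - 1 -> i < s by lia.
have ls' i : i < k - 1 -> k - 1 + i < s by lia.
have lt i : i < k - 1 -> i < t by lia.
have lt' i : i < k - 1 -> k - 1 + i < t by lia.
(* Parts 2 and 3 take indices shifted by [k - 1], which fit because [2 * (k - 1) <= s <= t]. *)
pose f (i : 'I_(k - 1)) : G := match j with
  | 0 => inl (Ordinal (ls i (ltn_ord i)))
  | 1 => inr (Ordinal (lt i (ltn_ord i)))
  | 2 => inl (Ordinal (ls' i (ltn_ord i)))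
  | _ => inr (Ordinal (lt' i (ltn_ord i))) end.
have f_inj : injective f.
  by rewrite /f; case: (j) => [|[|[|?]]] a b [] E; apply/val_inj => /=; lia.
rewrite -{1}(card_ord (k - 1)) -(card_imset _ f_inj) subset_leq_card //.
apply/subsetP => _ /imsetP[i _ ->]; rewrite inE /f.
by move: j4 (ltn_ord i); case: (j) => [|[|[|[|?]]]] //= _ hi; case: ifP => //; lia.
Qed.

Lemma cyclic_coloringE x y :
  cyclic_coloring [set x; y] = ((part x)./2 != (part y)./2).+1.
Proof.
rewrite /cyclic_coloring.
suff -> : [forall a in [set x; y], forall b in [set x; y],
    (part a)./2 == (part b)./2] = ((part x)./2 == (part y)./2) by case: ifP.
apply/idP/idP.
  by move=> /forall_inP/(_ _ (set21 _ _))/forall_inP/(_ _ (set22 _ _)).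
move=> /eqP E; apply/forall_inP => a /set2P ha; apply/forall_inP => b /set2P hb.
by case: ha hb => -> [] ->; rewrite ?E.
Qed.

(** * Tours around the four parts *)

Section Cover.
Variables (S : {set G}) (x0 : G).

(** Vertices of [S] come first, so that the earliest rounds of a tour collect them. *)
Definition part_list j : seq G :=
  enum (S :&: [set x | part x == j]) ++ enum ([set x | part x == j] :\: S).

Lemma size_part_list j : size (part_list j) = #|[set x : G | part x == j]|.
Proof. by rewrite size_cat -!cardE setIC cardsID. Qed.

Lemma mem_part_list j x : (x \in part_list j) = (part x == j).
Proof. by rewrite mem_cat !mem_enum !inE; case: (x \in S); rewrite ?orbF. Qed.

Lemma uniq_part_list j : uniq (part_list j).
Proof.
rewrite cat_uniq !enum_uniq andbT /=; apply/hasPn => x.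
by rewrite !mem_enum !inE => /andP[/negPf ->].
Qed.

Lemma index_part_list x : x \in S ->
  index x (part_list (part x)) < #|S :&: [set y | part y == part x]|.
Proof.
move=> xS; have xI : x \in enum (S :&: [set y | part y == part x]).
  by rewrite mem_enum !inE xS eqxx.
by rewrite index_cat xI cardE index_mem.
Qed.

Definition tour r i : G := nth x0 (part_list ((r + i) %% 4)) (i %/ 4).

(** The size condition keeps [nth] off its default [x0]. A position is determined by its residue and
    quotient modulo 4, so no vertex repeats; successive parts differ by 1 modulo 4, so the colors
    alternate. *)
Lemma tour_proper_tree r n : 0 < n ->
  (forall i, i < n -> i %/ 4 < size (part_list ((r + i) %% 4))) ->
  (forall x, x \in S -> exists2 i, i < n & x = tour r i) ->
  exists W F, proper_Stree cyclic_coloring S W F.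
Proof.
move=> n_gt0 n_size n_cover.
have part_tour i : i < n -> part (tour r i) = (r + i) %% 4.
  by move=> hi; apply/eqP; rewrite -mem_part_list mem_nth ?n_size.
have t_inj : {in [pred i | i < n] &, injective (tour r)}.
  move=> i j; rewrite !inE => hi hj E.
  have Em : (r + i) %% 4 = (r + j) %% 4 by rewrite -!part_tour // E.
  move/eqP: E; rewrite /tour Em nth_uniq ?uniq_part_list -?Em ?n_size //; last first.
    by rewrite Em n_size.
  by move=> /eqP; lia.
exists (path_vertices n (tour r)), (path_edges n (tour r)); split.
- apply: path_tree => // i hi; rewrite part_adj !part_tour //; lia.
- by apply/subsetP => x /n_cover ?; apply/path_verticesP.
- apply: path_properly_colored => // i hi.
  by rewrite !cyclic_coloringE !part_tour //; lia.
Qed.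

End Cover.

Lemma cyclic_coloring_proper : k_proper_coloring k 2 cyclic_coloring.
Proof.
split=> [e _|S S_k]; first by rewrite /cyclic_coloring; case: ifP.
have /card_gt0P[x0 _] : 0 < #|S| by lia.
pose part_in j := S :&: [set y | part y == j].
(* As [S] has [k] vertices, a part with at least [k] of them contains all of [S]. *)
have [/existsP[[r r4] /= r_big]|no_big] :=
    boolP [exists j : 'I_4, k <= #|part_in j|].
  have r_all x : x \in S -> part x = r.
    have /eqP <- : part_in r == S by rewrite eqEcard subsetIl S_k.
    by rewrite !inE => /andP[_ /eqP].
  have r_size : k <= #|[set x | part x == r]|.
    exact: leq_trans r_big (subset_leq_card (subsetIr _ _)).
  (* After [k - 1] full rounds, the extra position lies in part [r] and yields its [k]-th vertex;
     only there are more than [k - 1] vertices needed. *)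
  apply: (@tour_proper_tree S x0 r (4 * (k - 1)).+1) => // [i hi|x xS].
    rewrite size_part_list; have := @card_part ((r + i) %% 4) (@ltn_pmod _ 4 isT).
    have [E|E] : i %/ 4 < k - 1 \/ (r + i) %% 4 = r by lia.
      exact: leq_trans.
    by rewrite E => _; apply: leq_trans r_size; lia.
  have := index_part_list xS; rewrite r_all // => hx.
  have hx' : index x (part_list S r) < k.
    by apply: leq_trans hx _; rewrite -S_k subset_leq_card// subsetIl.
  exists (4 * index x (part_list S r)); first lia.
  rewrite /tour (_ : _ %% 4 = r); last lia.
  by rewrite mulKn // nth_index // mem_part_list r_all.
have small j : j < 4 -> #|part_in j| <= k - 1.
  move=> j4; move: no_big; rewrite negb_exists => /forallP/(_ (Ordinal j4)) /=.
  lia.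
apply: (@tour_proper_tree S x0 0 (4 * (k - 1))) => [|i hi|x xS]; first lia.
  rewrite size_part_list; apply: leq_trans (@card_part _ (@ltn_pmod _ 4 isT)); lia.
have := index_part_list xS; have := small _ (part_lt4 x); have := part_lt4 x.
rewrite /part_in => x4 x_small hx.
(* Starting from part 0, each round meets part [j] at offset [j]. *)
exists (4 * index x (part_list S (part x)) + part x); first lia.
rewrite /tour (_ : _ %% 4 = part x); last lia.
rewrite (_ : _ %/ 4 = index x (part_list S (part x))); last lia.
by rewrite nth_index // mem_part_list.
Qed.

End Coloring.

Theorem theorem11 (k s t : nat) (hk : 3 <= k) (hs : 2 * (k - 1) <= s)
  (hst : s <= t) : px (biclique s t) k = 2.
Proof.
have lower n : k_proper_colorable (biclique s t) k n -> 2 <= n.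
  case=> c [c_col c_trees]; rewrite leqNgt; apply/negP => n_le1.
  (* Some [k]-set must exist for [c_trees] to apply. *)
  have : k <= #|[set: biclique s t]|.
    by rewrite cardsT card_sum !card_ord; lia.
  case/card_geqP=> l [l_uniq l_size _].
  pose S := [set x in l].
  have S_k : #|S| = k by rewrite cardsE; move/card_uniqP: l_uniq => ->.
  have [W [F T]] := c_trees S S_k.
  by have := monochromatic_tree_small c_col n_le1 T; lia.
have upper : k_proper_colorable (biclique s t) k 2.
  by exists (@cyclic_coloring k s t); apply: cyclic_coloring_proper.
apply: classical_sets.xget_unique => [|m [m_col m_min]]; first by split.
by apply/eqP; rewrite eqn_leq m_min // lower.
Qed.
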